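(* Let $k$ be an algebraically closed field of characteristic zero, let $2\le n<d$ and $0\le\alpha_0\le\cdots\le\alpha_n<d$ be integers with $\mathrm{GCD}(\alpha_0,\ldots,\alpha_n,d)=1$, and let $e\in k$ be a primitive $d$th root of unity. Let $\Lambda\subset GL(n+1,k)$ be the cyclic group of order $d$ generated by $\mathrm{diag}(e^{\alpha_0},\ldots,e^{\alpha_n})$ and let $\overline{\Lambda}\subset GL(n+1,k)$ be the abelian group generated by $\mathrm{diag}(e^{\alpha_0},\ldots,e^{\alpha_n})$ and $\mathrm{diag}(e,\ldots,e)$. Let $\{m_1,\ldots,m_{\mu_d}\}$ be the set of all monomials of degree $d$ in $R=k[x_0,\ldots,x_n]$ which are invariants of $\Lambda$. Then $\{m_1,\ldots,m_{\mu_d}\}$ is a $k$-algebra basis of $R^{\overline{\Lambda}}$, i.e. $R^{\overline{\Lambda}}=k[m_1,\ldots,m_{\mu_d}]$.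
   Context: A diagonal matrix $\mathrm{diag}(c_0,\ldots,c_n)$ acts on $R$ by the $k$-algebra automorphism $x_i\mapsto c_i x_i$. For a finite group $G\subset GL(n+1,k)$, $R^G$ is the subring of polynomials fixed by all elements of $G$. A ''$k$-algebra basis'' of $R^{\overline\Lambda}$ means a set of elements generating it as a $k$-algebra (no algebraic independence is required). *)

(* Defs.v *)
From mathcomp Require Import all_boot all_order all_algebra.
From mathcomp Require Export mpoly.

Set Implicit Arguments.
Unset Strict Implicit.
Unset Printing Implicit Defensive.

Import GRing.Theory.
Local Open Scope ring_scope.

(* k is infinite here, so the finite group library (finGroupType, {'GL_n[R]})
   does not apply: subgroups of GL(n, k) are Prop-valued sets of matrices. *)
Definition is_GL_subgroup (k : fieldType) (n : nat) (H : 'M[k]_n -> Prop) :=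
  [/\ forall g, H g -> g \in unitmx,
      H 1%:M,
      forall g h, H g -> H h -> H (g *m h)
    & forall g, H g -> H (invmx g)].

(* Meaningful when all the elements of S are invertible. *)
Definition generated_GL (k : fieldType) (n : nat) (S : 'M[k]_n -> Prop)
    (g : 'M[k]_n) :=
  forall H : 'M[k]_n -> Prop,
    is_GL_subgroup H -> (forall s, S s -> H s) -> H g.

(* The k-algebra endomorphism x_i |-> \sum_j g_ij x_j; for g = diag(c) it is
   x_i |-> c_i x_i. *)
Definition mx_subst (k : fieldType) (n : nat) (g : 'M[k]_n)
    (p : {mpoly k[n]}) : {mpoly k[n]} :=
  p \mPo [tuple \sum_j g i j *: 'X_j | i < n].

Definition invariant_poly (k : fieldType) (n : nat) (G : 'M[k]_n -> Prop)
    (p : {mpoly k[n]}) :=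
  forall g, G g -> mx_subst g p = p.

Definition is_monomial_of_degree (k : fieldType) (n d : nat)
    (p : {mpoly k[n]}) :=
  exists a : 'X_{1..n}, mdeg a = d /\ p = 'X_[a].

(* Prop-valued counterpart of GRing.subalg_closed. *)
Definition is_subalgebra (k : fieldType) (A : algType k) (B : A -> Prop) :=
  [/\ B 1,
      forall (c : k) (u v : A), B u -> B v -> B (c *: u + v)
    & forall u v : A, B u -> B v -> B (u * v)].

Definition generated_subalgebra (k : fieldType) (A : algType k)
    (S : A -> Prop) (f : A) :=
  forall B : A -> Prop, is_subalgebra B -> (forall s, S s -> B s) -> B f.

(* Main.v *)
Require Import Defs.
From mathcomp Require Import all_boot all_order all_algebra.
From mathcomp Require Import cyclic zify.

Set Implicit Arguments.
Unset Strict Implicit.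
Unset Printing Implicit Defensive.

(** A diagonal matrix multiplies each monomial by a scalar, so a polynomial is
    invariant under diagonal matrices exactly when each monomial of its support
    is.  Since [e] has order [d], the monomial with exponents [m] is fixed by
    both generators of the big group precisely when [d] divides its degree
    [\sum_i m i] and its weight [\sum_i alpha i * m i].  What has to be shown
    is therefore that each such monomial, of degree [d * t] say, is a product
    of [t] monomials of degree [d] whose weights are divisible by [d].

    Write the monomial as a product of [d * t] variables, that is, as a
    sequence of indices carrying the integers [alpha i].  The theorem of Erdos,
    Ginzburg and Ziv ([EGZ]) says that among any [2 * d - 1] integers some [d]
    have a sum divisible by [d].  As long as [t >= 2] it splits off one block of
    [d] variables of weight divisible by [d]; what remains has the same
    divisibility properties, and for [t = 1] it is itself such a block
    ([zero_sum_block_decomposition]).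

    The Erdos-Ginzburg-Ziv theorem is proved for a prime [p] by a double count
    modulo [p] ([EGZ_prime_set]): if no [p] of the [2 * p - 1] integers had a
    sum divisible by [p], then by Fermat the sum of the [(p - 1)]-st powers of
    all the [p]-element sums would be congruent to ['C(2p - 1, p - 1)], which
    is prime to [p]; but expanding the powers shows that all the coefficients
    are binomials divisible by [p].  The property is then multiplicative in [d]
    ([EGZ_mul]): group the integers into many blocks for the first factor and
    apply the property of the second factor to the quotients of their sums.

    The converse inclusion holds because the stabilizer of a polynomial is a
    group ([invariant_generated_GL]) and the invariants of any set of matrices
    form a subalgebra ([invariant_poly_subalgebra]). *)

(** * Binomial coefficients modulo a prime *)

(** The falling factorial [m ^_ p.-1] contains the factor [p], while
    [(p.-1)`!] is prime to [p]. *)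
Lemma dvdn_bin_predp p m : prime p -> p <= m -> m < p + p.-1 ->
  p %| 'C(m, p.-1).
Proof.
move=> p_pr le_pm lt_m; have p_gt1 := prime_gt1 p_pr.
have copF : coprime p (p.-1)`!.
  rewrite prime_coprime // fact_prod Euclid_dvd_prod // big_has_cond.
  apply/hasPn => i; rewrite mem_index_iota /= => i_lt.
  by rewrite gtnNdvd //; lia.
rewrite -(Gauss_dvdl _ copF) bin_ffact ffact_prod.
have lt_i : m - p < p.-1 by lia.
by rewrite (bigD1 (Ordinal lt_i)) //= subKn // dvdn_mulr.
Qed.

(** The factors of the falling factorial [(2p - 1) ^_ p.-1] are
    [p + 1, ..., 2p - 1], none of them divisible by [p]. *)
Lemma ndvdn_bin_double_predp p : prime p -> ~~ (p %| 'C(p + p.-1, p.-1)).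
Proof.
move=> p_pr; have p_gt1 := prime_gt1 p_pr.
have: ~~ (p %| (p + p.-1) ^_ p.-1).
  rewrite ffact_prod Euclid_dvd_prod // big_has_cond; apply/hasPn => i _ /=.
  rewrite -addnBA; last by have := ltn_ord i; lia.
  by rewrite dvdn_addr // gtnNdvd //; have := ltn_ord i; lia.
by rewrite -bin_ffact; apply: contra => ?; rewrite dvdn_mulr.
Qed.

(** * The Erdos-Ginzburg-Ziv theorem *)

(** Expanding the [q]-th power yields one product for each [f : 'I_q -> I]
    avoiding [C].  After exchanging the sums, the product of a given [f] is
    counted once for every [k]-set [C] disjoint from the image of [f]. *)
Lemma sum_expn_codraws (I : finType) (a : I -> nat) (q k : nat) :
  \sum_(C : {set I} | #|C| == k) (\sum_(i in ~: C) a i) ^ q =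
  \sum_(f : {ffun 'I_q -> I})
     'C(#|~: (f @: 'I_q)|, k) * \prod_j a (f j).
Proof.
under eq_bigr => C _.
  rewrite -[X in _ ^ X]card_ord -prod_nat_const bigA_distr_big.
  rewrite big_mkcond /=. over.
rewrite exchange_big /=; apply: eq_bigr => f _.
rewrite -big_mkcondr sum_nat_const; congr (_ * _).
rewrite -cards_draws -sum1dep_card -sum1_card; apply: eq_bigl => C.
rewrite unfold_in andbC; congr (_ && _).
apply/ffun_onP/subsetP => [fC x xC | sub j].
  by rewrite inE; apply/imsetP => -[j _ xE]; have := fC j; rewrite -xE inE xC.
by rewrite inE; apply/negP => /sub; rewrite inE imset_f.
Qed.

(** The [p]-sets are handled through their complements, which have [p.-1]
    elements.  A function [f] from ['I_p.-1] has an image of size between [1]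
    and [p.-1], so its coefficient in [sum_expn_codraws] is ['C(m, p.-1)] with
    [p <= m < p + p.-1]. *)
Lemma EGZ_prime_set p (I : finType) (a : I -> nat) :
  prime p -> #|I| = p + p.-1 ->
  exists2 S : {set I}, #|S| = p & p %| \sum_(i in S) a i.
Proof.
move=> p_pr cardI; have p_gt1 := prime_gt1 p_pr.
case: (boolP [exists S : {set I}, (#|S| == p) && (p %| \sum_(i in S) a i)]).
  by case/existsP=> S /andP[/eqP ? ?]; exists S.
rewrite negb_exists => /forallP noS; case/negP: (ndvdn_bin_double_predp p_pr).
have: p %| \sum_(C : {set I} | #|C| == p.-1) (\sum_(i in ~: C) a i) ^ p.-1.
  rewrite sum_expn_codraws dvdn_sum // => f _; rewrite dvdn_mulr //.
  have := cardsC (f @: 'I_p.-1); rewrite cardI => cardC.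
  have le_im : #|f @: 'I_p.-1| <= p.-1.
    by rewrite (leq_trans (leq_imset_card _ _)) ?card_ord.
  have im_gt0 : 0 < #|f @: 'I_p.-1|.
    have lt0 : 0 < p.-1 by lia.
    by apply/card_gt0P; exists (f (Ordinal lt0)); rewrite imset_f.
  move: cardC le_im im_gt0; move: #|f @: _| #|~: _| => u v *.
  by apply: dvdn_bin_predp => //; lia.
rewrite /dvdn => /eqP<-; apply/eqP.
(* The binomial coefficient is a sum of ones over the same index sets, so the
   congruence can be checked term by term. *)
rewrite -cardI -cardsT -cards_draws -sum1dep_card.
rewrite -[LHS]modn_summ -[RHS]modn_summ.
congr (_ %% p).
rewrite (eq_bigl (fun C : {set I} => #|C| == p.-1)) => [|C]; last first.
  by rewrite subsetT.
apply: eq_bigr => C /eqP cardC.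
have := noS (~: C); have := cardsC C; rewrite cardI cardC => cC.
have -> /= : #|~: C| == p by move: #|~: C| cC => u; lia.
set x := \sum_(i in _) _ => nx.
by rewrite -totient_prime // Euler_exp_totient // coprime_sym prime_coprime.
Qed.

Definition zero_sum_block (T : Type) (f : T -> nat) d (t : seq T) :=
  (size t == d) && (d %| \sum_(x <- t) f x).

(** The elements are weighted by [f], and not integers themselves, over an
    arbitrary type: [EGZ_mul] applies the property to sequences of blocks. *)
Definition EGZ_property d := forall (T : eqType) (f : T -> nat) (s : seq T),
  d + d.-1 <= size s ->
  exists t r, perm_eq s (t ++ r) /\ zero_sum_block f d t.

Lemma EGZ_prime p : prime p -> EGZ_property p.
Proof.
move=> p_pr T f s le_s; have p_gt1 := prime_gt1 p_pr.
have [x0 _] : exists x0 : T, true by case: s le_s => [|x s] /=; [lia | exists x].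
set n := p + p.-1 in le_s.
have [S cardS dvS] := EGZ_prime_set (fun i : 'I_n => f (nth x0 s i)) p_pr (card_ord _).
exists [seq nth x0 s (val i) | i <- enum S].
exists ([seq nth x0 s (val i) | i <- enum (~: S)] ++ drop n s).
split; last by rewrite /zero_sum_block size_map -cardE cardS eqxx big_map big_enum.
rewrite catA -map_cat -[X in perm_eq X _](cat_take_drop n s) perm_cat2r.
have -> : take n s = [seq nth x0 s (val i) | i <- enum 'I_n].
  by rewrite (map_comp (nth x0 s)) val_enum_ord map_nth_iota0.
apply: perm_map; apply: uniq_perm; rewrite ?enum_uniq //.
  rewrite cat_uniq !enum_uniq andbT /=; apply/hasPn => i.
  by rewrite !mem_enum inE.
by move=> i; rewrite mem_cat !mem_enum !inE orbN.
Qed.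

(** A block can be split off while [d + d.-1] elements remain, whence the
    bound [k * d + d.-1]. *)
Lemma EGZ_blocks d k (T : eqType) (f : T -> nat) (s : seq T) :
  EGZ_property d -> k * d + d.-1 <= size s ->
  exists ss r, [/\ perm_eq s (flatten ss ++ r), size ss = k &
                   all (zero_sum_block f d) ss].
Proof.
move=> egz; elim: k s => [|k IHk] s le_s; first by exists [::], s.
have [|t [r [st zt]]] := egz T f s; first by lia.
have szt : size t = d by case/andP: zt => /eqP.
have [|ss [r' [rss <- zss]]] := IHk r.
  by have := perm_size st; rewrite size_cat szt; lia.
exists (t :: ss), r'; split; rewrite /= ?zt //.
by rewrite (perm_trans st) // -catA perm_cat2l.
Qed.

Lemma sum_flatten_blocks d (T : Type) (f : T -> nat) (ss : seq (seq T)) :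
  all (zero_sum_block f d) ss ->
  size (flatten ss) = size ss * d /\
  \sum_(x <- flatten ss) f x = d * \sum_(t <- ss) (\sum_(x <- t) f x) %/ d.
Proof.
elim: ss => [|t ss IHss] /=; first by rewrite !big_nil muln0.
case/andP=> /andP[/eqP szt dt] /IHss[szss sumss].
by rewrite size_cat szss szt big_cat sumss big_cons mulnDr [d * (_ %/ d)]mulnC divnK.
Qed.

(** From [2 * d1 * d2 - 1] elements one can extract [2 * d2 - 1] blocks for
    [d1].  Weight each by its sum divided by [d1]: a choice of [d2] blocks of
    total weight divisible by [d2] is a block for [d1 * d2]. *)
Lemma EGZ_mul d1 d2 : 0 < d1 -> 0 < d2 ->
  EGZ_property d1 -> EGZ_property d2 -> EGZ_property (d1 * d2).
Proof.
move=> d1_gt0 d2_gt0 egz1 egz2 T f s le_s.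
have [|ss [r [sss szss zss]]] := @EGZ_blocks d1 (d2 + d2.-1) T f s egz1.
  by apply: leq_trans le_s; nia.
have [|tt [rr [ssE /andP[/eqP sztt dtt]]]] :=
  egz2 _ (fun t => (\sum_(x <- t) f x) %/ d1) ss; first by rewrite szss.
have ztt : all (zero_sum_block f d1) tt.
  by move: zss; rewrite (perm_all _ ssE) all_cat => /andP[].
have [szft sumft] := sum_flatten_blocks ztt.
exists (flatten tt), (flatten rr ++ r); split; last first.
  by rewrite /zero_sum_block szft sztt mulnC eqxx sumft dvdn_pmul2l.
by rewrite (perm_trans sss) // catA perm_cat2r -flatten_cat perm_flatten.
Qed.

Lemma EGZ d : 0 < d -> EGZ_property d.
Proof.
elim/ltn_ind: d => d IHd d_gt0; case: (ltnP 1 d) => [d_gt1|d_le1].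
  have p_pr := pdiv_prime d_gt1; have p_gt1 := prime_gt1 p_pr.
  have q_gt0 : 0 < d %/ pdiv d.
    by rewrite divn_gt0 ?pdiv_gt0 // dvdn_leq // pdiv_dvd.
  rewrite -(divnK (pdiv_dvd d)); apply: EGZ_mul; rewrite ?pdiv_gt0 //.
    by apply: IHd => //; rewrite ltn_Pdiv.
  exact: EGZ_prime.
have -> : d = 1 by lia.
move=> T f [|x s] // _; exists [:: x], s; split=> //.
by rewrite /zero_sum_block /= dvd1n.
Qed.

(** Blocks are split off one at a time; when exactly [d] elements remain, too
    few for [EGZ] if [d > 1], they already form a block. *)
Lemma zero_sum_block_decomposition d (T : eqType) (f : T -> nat) (s : seq T) :
  0 < d -> d %| size s -> d %| \sum_(x <- s) f x ->
  exists2 ss, perm_eq s (flatten ss) & all (zero_sum_block f d) ss.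
Proof.
move=> d_gt0 /dvdnP[k]; elim: k s => [|k IHk] s szs ds.
  by exists [::]; case: s szs ds.
case: k => [|k] in IHk szs *.
  by exists [:: s]; rewrite /= ?cats0 // /zero_sum_block szs mul1n eqxx ds.
have [|t [r [st zt]]] := @EGZ d d_gt0 T f s; first by rewrite szs; nia.
have /andP[/eqP szt dt] := zt.
have [||ss rss zss] := IHk r.
- by have := perm_size st; rewrite size_cat szs szt; lia.
- by move: ds; rewrite (perm_big _ st) big_cat /= dvdn_addr.
exists (t :: ss); rewrite /= ?zt //.
by rewrite (perm_trans st) // perm_cat2l.
Qed.

Import GRing.Theory.
Local Open Scope ring_scope.

(** * Linear substitutions and their invariants *)

Lemma mx_substX (k : fieldType) (n : nat) (g : 'M[k]_n) (m : 'X_{1..n}) :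
  mx_subst g 'X_[m] = \prod_i (\sum_j g i j *: 'X_j) ^+ m i.
Proof.
by rewrite /mx_subst comp_mpolyX; apply: eq_bigr => i _; rewrite tnth_mktuple.
Qed.

Lemma mx_substM (k : fieldType) (n : nat) (g h : 'M[k]_n) (p : {mpoly k[n]}) :
  mx_subst (g *m h) p = mx_subst h (mx_subst g p).
Proof.
rewrite [LHS]comp_mpolyEX [mx_subst g p]comp_mpolyEX [RHS]raddf_sum.
apply: eq_bigr => m _; rewrite [RHS]comp_mpolyZ; congr (_ *: _).
rewrite -!/(mx_subst _ _) !mx_substX /mx_subst rmorph_prod.
apply: eq_bigr => i _; rewrite rmorphXn raddf_sum; congr (_ ^+ _).
under [RHS]eq_bigr => l _.
  rewrite /= comp_mpolyZ comp_mpolyXU -tnth_nth tnth_mktuple scaler_sumr.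
  under eq_bigr => j _ do rewrite scalerA.
  over.
rewrite exchange_big; apply: eq_bigr => j _.
by rewrite mxE scaler_suml.
Qed.

Lemma mx_subst_diag (k : fieldType) (n : nat) (c : 'rV[k]_n) (m : 'X_{1..n}) :
  mx_subst (diag_mx c) 'X_[m] = (\prod_i c 0 i ^+ m i) *: 'X_[m].
Proof.
rewrite mx_substX [in RHS]mpolyXE_id -scaler_prod; apply: eq_bigr => i _.
rewrite -exprZn; congr (_ ^+ _); rewrite (bigD1 i) //= big1 ?addr0.
  by rewrite mxE eqxx mulr1n.
by move=> j nij; rewrite mxE eq_sym (negbTE nij) mulr0n scale0r.
Qed.

Lemma mx_subst1 (k : fieldType) (n : nat) (p : {mpoly k[n]}) :
  mx_subst 1%:M p = p.
Proof.
rewrite [LHS]comp_mpolyEX [RHS]mpolyE; apply: eq_bigr => m _.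
rewrite -/(mx_subst _ _).
rewrite -diag_const_mx mx_subst_diag big1 ?scale1r // => i _.
by rewrite mxE expr1n.
Qed.

Lemma mcoeff_mx_subst_diag (k : fieldType) (n : nat) (c : 'rV[k]_n)
    (p : {mpoly k[n]}) (m : 'X_{1..n}) :
  (mx_subst (diag_mx c) p)@_m = (\prod_i c 0 i ^+ m i) * p@_m.
Proof.
rewrite [mx_subst _ _]comp_mpolyEX [in RHS](mpolyE p) !raddf_sum mulr_sumr /=.
apply: eq_bigr => a _; rewrite -/(mx_subst _ _) mx_subst_diag.
rewrite !mcoeffZ mcoeffX; case: eqP => [->|_]; last by rewrite !mulr0.
by rewrite mulrCA.
Qed.

(** Invariance need only be tested on generators, because the invertible
    matrices that fix [p] form a group. *)
Lemma invariant_generated_GL (k : fieldType) (n : nat) (S : 'M[k]_n -> Prop)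
    (p : {mpoly k[n]}) :
  (forall s, S s -> s \in unitmx /\ mx_subst s p = p) ->
  invariant_poly (generated_GL S) p.
Proof.
move=> Sfix g Sg.
suff [] : g \in unitmx /\ mx_subst g p = p by [].
apply: (Sg (fun g => g \in unitmx /\ mx_subst g p = p)) => //; split.
- by move=> h [].
- by rewrite unitmx1 mx_subst1.
- by move=> h1 h2 [u1 f1] [u2 f2]; rewrite unitmx_mul u1 u2 mx_substM f1.
- by move=> h [u f]; rewrite unitmx_inv -{1}f -mx_substM mulmxV // mx_subst1.
Qed.

Lemma generated_GL_mem (k : fieldType) (n : nat) (S : 'M[k]_n -> Prop)
    (s : 'M[k]_n) : S s -> generated_GL S s.
Proof. by move=> Ss H _; apply. Qed.

Lemma invariant_poly_subalgebra (k : fieldType) (n : nat) (G : 'M[k]_n -> Prop) :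
  is_subalgebra (invariant_poly G).
Proof.
split=> [g _|c u v fu fv g Gg|u v fu fv g Gg]; rewrite /mx_subst.
- exact: rmorph1.
- by rewrite linearP /= -!/(mx_subst _ _) fu // fv.
- by rewrite rmorphM /= -!/(mx_subst _ _) fu // fv.
Qed.

(** * Subalgebras *)

Lemma subalgebra0 (k : fieldType) (A : algType k) (B : A -> Prop) :
  is_subalgebra B -> B 0.
Proof. by case=> B1 BZ _; rewrite -(addNr 1) -scaleN1r; apply: BZ. Qed.

Lemma subalgebra_sumZ (k : fieldType) (A : algType k) (B : A -> Prop)
   (I : eqType) (r : seq I) (c : I -> k) (u : I -> A) :
  is_subalgebra B -> (forall i, i \in r -> B (u i)) ->
  B (\sum_(i <- r) c i *: u i).
Proof.
move=> sB; have [_ BZ _] := sB; elim: r => [|i r IHr] Br.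
  by rewrite big_nil; apply: subalgebra0.
rewrite big_cons; apply: BZ; first by apply: Br; rewrite mem_head.
by apply: IHr => j jr; apply: Br; rewrite in_cons jr orbT.
Qed.

(** * Monomials as sequences of variables *)

Definition mnm_of_seq n (s : seq 'I_n) : 'X_{1..n} := (\sum_(i <- s) U_(i))%MM.

Lemma mnm_as_seq n (m : 'X_{1..n}) : exists s, m = mnm_of_seq s.
Proof.
exists (flatten [seq nseq (m i) i | i <- enum 'I_n]).
rewrite /mnm_of_seq big_flatten big_map big_enum /=.
rewrite {1}(multinomUE_id m); apply: eq_bigr => i _.
by rewrite big_nseq /mnm_muln Monoid.iteropE.
Qed.

Lemma mdeg_mnm_of_seq n (s : seq 'I_n) : mdeg (mnm_of_seq s) = size s.
Proof.
rewrite /mnm_of_seq mdeg_sum -sum1_size.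
by apply: eq_bigr => i _; rewrite mdeg1.
Qed.

Lemma weight_mnm_of_seq n (w : 'I_n -> nat) (s : seq 'I_n) :
  (\sum_i w i * mnm_of_seq s i = \sum_(i <- s) w i)%N.
Proof.
under eq_bigr => i _ do rewrite mnm_sumE big_distrr /=.
rewrite exchange_big; apply: eq_bigr => j _.
rewrite (bigD1 j) //= mnm1E eqxx muln1 big1 ?addn0 // => i nij.
by rewrite mnm1E eq_sym (negbTE nij) muln0.
Qed.

(** Concatenating sequences of variables multiplies their monomials. *)
Lemma mpolyX_flatten_in_subalgebra (k : fieldType) n (B : {mpoly k[n]} -> Prop)
   (ss : seq (seq 'I_n)) :
  is_subalgebra B -> (forall t, t \in ss -> B 'X_[mnm_of_seq t]) ->
  B 'X_[mnm_of_seq (flatten ss)].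
Proof.
case=> B1 _ BM Bss; rewrite /mnm_of_seq big_flatten -mprodXE.
elim: ss Bss => [|t ss IHss] Bss; first by rewrite big_nil.
rewrite big_cons; apply: BM; first by apply: Bss; rewrite mem_head.
by apply: IHss => u uss; apply: Bss; rewrite in_cons uss orbT.
Qed.

(** * Diagonal matrices of powers of a root of unity *)

Lemma unitmx_diag (k : fieldType) n (c : 'rV[k]_n) :
  (forall i, c 0 i != 0) -> diag_mx c \in unitmx.
Proof.
by move=> c0; rewrite unitmxE det_diag unitfE; apply/prodf_neq0 => i _.
Qed.

Lemma prod_expr_weight (k : fieldType) n (e : k) (w : 'I_n -> nat)
    (m : 'X_{1..n}) :
  \prod_i ((\row_i e ^+ w i) 0 i) ^+ m i = e ^+ (\sum_i w i * m i)%N.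
Proof. by rewrite -prodrXr; apply: eq_bigr => i _; rewrite mxE exprM. Qed.

Lemma invariant_mpolyX_diag (k : fieldType) n (d : nat) (e : k)
    (w : 'I_n -> nat) (m : 'X_{1..n}) :
  d.-primitive_root e ->
  mx_subst (diag_mx (\row_i e ^+ w i)) 'X_[m] = 'X_[m] <->
  (d %| \sum_i w i * m i)%N.
Proof.
move=> e_prim; rewrite mx_subst_diag prod_expr_weight (prim_order_dvd e_prim).
split=> [/(congr1 (mcoeff m))|/eqP->]; last by rewrite scale1r.
by rewrite mcoeffZ mcoeffX eqxx mulr1 => ->.
Qed.

Theorem theorem3p1 (k : closedFieldType) (n d : nat) (alpha : 'I_n.+1 -> nat)
    (e : k) :
  [pchar k] =i pred0 ->
  (2 <= n < d)%N ->
  (forall i j : 'I_n.+1, (i <= j)%N -> (alpha i <= alpha j)%N) ->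
  (alpha ord_max < d)%N ->
  gcdn (\big[gcdn/0%N]_(i < n.+1) alpha i) d = 1%N ->
  d.-primitive_root e ->
  let A : 'M[k]_n.+1 := diag_mx (\row_i e ^+ alpha i) in
  let E : 'M[k]_n.+1 := diag_mx (\row_i e) in
  let Lambda := generated_GL (fun g => g = A) in
  let Lambda_bar := generated_GL (fun g => g = A \/ g = E) in
  forall f : {mpoly k[n.+1]},
    invariant_poly Lambda_bar f <->
    generated_subalgebra
      (fun m : {mpoly k[n.+1]} =>
         is_monomial_of_degree d m /\ invariant_poly Lambda m) f.
Proof.
move=> _ _ _ _ _ e_prim A E Lambda Lambda_bar f.
have d_gt0 := prim_order_gt0 e_prim.
have e_neq0 : e != 0.
  apply/eqP=> e0; have /eqP := prim_expr_order e_prim.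
  by rewrite e0 expr0n gtn_eqF // eq_sym oner_eq0.
have A_unit : A \in unitmx by apply: unitmx_diag => i; rewrite mxE expf_neq0.
have E_unit : E \in unitmx by apply: unitmx_diag => i; rewrite mxE.
(* Scalar multiplication by [e] is the diagonal action with all weights equal
   to one, for which the weight of a monomial is its degree. *)
have EE : E = diag_mx (\row_i e ^+ 1).
  by congr diag_mx; apply/rowP => i; rewrite !mxE expr1.
have wE (m : 'X_{1..n.+1}) : (\sum_i 1 * m i)%N = mdeg m.
  by rewrite mdegE; apply: eq_bigr => i _; rewrite mul1n.
split=> [inv_f|gen_f]; last first.
  apply: (gen_f _ (invariant_poly_subalgebra _)) => _ [[m [deg_m ->]] inv_m].
  apply: invariant_generated_GL => _ [->|->]; split=> //.
    exact: inv_m _ (generated_GL_mem _).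
  by rewrite EE; apply/(invariant_mpolyX_diag _ _ e_prim); rewrite wE deg_m.
move=> B sB BS; rewrite (mpolyE f).
apply: subalgebra_sumZ => // m; rewrite mcoeff_msupp => m_f.
(* A weighted diagonal matrix that fixes [f] must fix each monomial of its
   support, whence a divisibility condition on the weight. *)
have dvd_m w :
    Lambda_bar (diag_mx (\row_i e ^+ w i)) -> (d %| \sum_i w i * m i)%N.
  move=> /inv_f /(congr1 (mcoeff m)); rewrite mcoeff_mx_subst_diag prod_expr_weight.
  by rewrite -[RHS]mul1r => /(mulIf m_f)/eqP; rewrite -(prim_order_dvd e_prim).
have dvd_w := dvd_m alpha (generated_GL_mem (or_introl erefl)).
have dvd_deg : (d %| mdeg m)%N.
  rewrite -wE; apply: (dvd_m (fun=> 1%N)).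
  by rewrite -EE; apply: generated_GL_mem; right.
have [s mE] := mnm_as_seq m; move: dvd_w dvd_deg.
rewrite {}mE mdeg_mnm_of_seq weight_mnm_of_seq => dvd_w dvd_sz.
have [ss sss zss] := zero_sum_block_decomposition d_gt0 dvd_sz dvd_w.
rewrite /mnm_of_seq (perm_big _ sss) -/(mnm_of_seq _).
apply: mpolyX_flatten_in_subalgebra => // t /(allP zss)/andP[/eqP szt dvd_t].
apply: BS; split; first by exists (mnm_of_seq t); rewrite mdeg_mnm_of_seq.
apply: invariant_generated_GL => _ ->; split=> //.
by apply/(invariant_mpolyX_diag _ _ e_prim); rewrite weight_mnm_of_seq.
Qed.
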